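(* For $i=1,2$, let $V_i$ be a locally linearly compact vector space over a discrete field $\mathbb K$ and let $\phi_i\colon V_i\to V_i$ be a continuous endomorphism. Let $V=V_1\times V_2$ (with the product topology) and $\phi=\phi_1\times\phi_2\colon V\to V$. Then $\mathrm{ent}(\phi)=\mathrm{ent}(\phi_1)+\mathrm{ent}(\phi_2)$.
   Context: $\mathbb K$ is an arbitrary field endowed with the discrete topology. A topological vector space over $\mathbb K$ is linearly topologized if it is Hausdorff and has a neighborhood basis at $0$ consisting of linear subspaces. A linear variety of $V$ is a coset $v+W$ of a linear subspace $W$; it is closed (open) if $W$ is closed (open). A linearly topologized vector space is linearly compact if every collection of closed linear varieties with the finite intersection property has non-empty intersection. A linearly topologized vector space is locally linearly compact (l.l.c.) if it has an open linear subspace that is linearly compact; $\mathcal B(V)$ denotes the family of all linearly compact open linear subspaces of $V$. ''Endomorphism'' means linear endomorphism. For a continuous endomorphism $\phi$ of an l.l.c. space $V$, $U\in\mathcal B(V)$ and a positive integer $n$, let $T_n(\phi,U)=U+\phi U+\dots+\phi^{n-1}U$. Define $H(\phi,U)=\lim_{n\to\infty}\frac1n\dim\frac{T_n(\phi,U)}{U}$ (the limit exists) and $\mathrm{ent}(\phi)=\sup\{H(\phi,U)\mid U\in\mathcal B(V)\}\in\mathbb N\cup\{\infty\}$, with the usual conventions for sums involving $\infty$. *)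

(* Defs.v *)
From HB Require Import structures.
From mathcomp Require Import all_boot all_order all_algebra.
From mathcomp Require Import all_classical all_reals topology ereal.

Set Implicit Arguments.
Unset Strict Implicit.
Unset Printing Implicit Defensive.

Import Order.TTheory GRing.Theory Num.Theory.

Local Open Scope classical_set_scope.
Local Open Scope ring_scope.

(* The library's topologicalLmodType requires a scalar ring with an order and a
   norm, hence a separate structure for scalars in an arbitrary field K, which
   carries the discrete topology. HB rejects it as incompatible with NbhsLmodule
   if tvs.v is loaded before this declaration (afterwards is fine). *)
HB.mixin Record isDiscreteTVS (K : fieldType) V
    & Topological V & GRing.Lmodule K V := {
  dtvs_add_continuous : continuous (fun z : V * V => z.1 + z.2) ;
  dtvs_scale_continuous :
    continuous (fun z : discrete_topology K * V => (z.1 : K) *: z.2) ;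
}.

#[short(type="dtvsType")]
HB.structure Definition DiscreteTVS (K : fieldType) :=
  {V of Topological V & GRing.Lmodule K V & isDiscreteTVS K V}.

Section product.
Context (K : fieldType) (V1 V2 : dtvsType K).

Let prod_add_continuous :
  continuous (fun z : (V1 * V2) * (V1 * V2) => z.1 + z.2).
Proof.
move=> [[x1 x2] [y1 y2]] U [[A B] /= [nA nB] ABU].
have [[A1 A2] /= [nA1 nA2] sA] := @dtvs_add_continuous K V1 (x1, y1) _ nA.
have [[B1 B2] /= [nB1 nB2] sB] := @dtvs_add_continuous K V2 (x2, y2) _ nB.
exists (A1 `*` B1, A2 `*` B2) => /=.
  by split; [exists (A1, B1)|exists (A2, B2)].
move=> [[a1 b1] [a2 b2]] /= [[? ?] [? ?]]; apply: ABU; split => /=.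
  exact: (sA (a1, a2)).
exact: (sB (b1, b2)).
Qed.

Let prod_scale_continuous : continuous
  (fun z : discrete_topology K * (V1 * V2) => (z.1 : K) *: z.2).
Proof.
move=> [r [x1 x2]] U [[A B] /= [nA nB] ABU].
have [[A1 A2] /= [nA1 nA2] sA] := @dtvs_scale_continuous K V1 (r, x1) _ nA.
have [[B1 B2] /= [nB1 nB2] sB] := @dtvs_scale_continuous K V2 (r, x2) _ nB.
exists (A1 `&` B1, A2 `*` B2) => /=.
  by split; [exact: (@filterI _ (nbhs (r : discrete_topology K)))|exists (A2, B2)].
move=> [l [a b]] /= [[? ?] [? ?]]; apply: ABU; split => /=.
  exact: (sA (l, a)).
exact: (sB (l, b)).
Qed.

HB.instance Definition _ := isDiscreteTVS.Build K (V1 * V2)%type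
  prod_add_continuous prod_scale_continuous.

Definition prod_endo (f1 : V1 -> V1) (f2 : V2 -> V2) (x : V1 * V2) : V1 * V2 :=
  (f1 x.1, f2 x.2).

Variables (f1 : {linear V1 -> V1}) (f2 : {linear V2 -> V2}).

Let prod_endo_linear : linear (prod_endo f1 f2).
Proof. by move=> a x y; rewrite /prod_endo/= !linearP. Qed.

HB.instance Definition _ := GRing.isLinear.Build K (V1 * V2)%type
  (V1 * V2)%type *:%R (prod_endo f1 f2) prod_endo_linear.

End product.

Section llc.
Context (K : fieldType) (V : dtvsType K).
Implicit Types (U W T A : set V).

Definition linear_subspace W := submod_closed [in W].

Definition linearly_topologized : Prop :=
  hausdorff_space V /\
  forall N : set V, nbhs 0 N ->
    exists W, [/\ linear_subspace W, nbhs 0 W & W `<=` N].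

(* Linear varieties of the space U, closed in the topology induced on U *)
Definition closed_variety U A : Prop :=
  exists (v : V) W, [/\ U v, linear_subspace W, W `<=` U,
    closed (W : set (subspace U)) & A = [set v + w | w in W]].

Definition linearly_compact U : Prop :=
  forall F : set (set V), F `<=` closed_variety U ->
    finI F id -> \bigcap_(A in F) A !=set0.

Definition lc_open_subspaces : set (set V) :=
  [set U | [/\ linear_subspace U, open U & linearly_compact U]].

Definition locally_linearly_compact : Prop :=
  linearly_topologized /\ lc_open_subspaces !=set0.

End llc.

Arguments linearly_topologized {K} V.
Arguments lc_open_subspaces {K} V.
Arguments locally_linearly_compact {K} V.

Section entropy.
Context (R : realType) (K : fieldType).

(* The classes of the b i form a basis of T / U. *)
Definition quotient_basis (V : lmodType K) (T U : set V) (n : nat)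
    (b : 'I_n -> V) : Prop :=
  [/\ forall i, T (b i),
      forall a : 'I_n -> K, U (\sum_(i < n) a i *: b i) -> forall i, a i = 0
    & forall x, T x -> exists a : 'I_n -> K, U (x - \sum_(i < n) a i *: b i)].

(* dim (T / U): the set below has at most one element, and it is empty, with
   infimum +oo, when T / U is infinite-dimensional. *)
Definition quotient_dim (V : lmodType K) (T U : set V) : \bar R :=
  ereal_inf [set (n%:R)%:E | n in
    [set n : nat | exists b : 'I_n -> V, quotient_basis T U b]].

(* T_n(phi, U) = U + phi U + ... + phi^(n-1) U *)
Definition trajectory (V : lmodType K) (phi : V -> V) (U : set V) (n : nat) :
    set V :=
  [set x | exists2 u : 'I_n -> V,
    forall i, U (u i) & x = \sum_(i < n) iter i phi (u i)].

Context (V : dtvsType K) (phi : {linear V -> V}).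

Definition ent_wrt (U : set V) : \bar R :=
  limn (fun n : nat =>
    ((n%:R^-1)%:E * quotient_dim (trajectory phi U n) U)%E).

Definition ent : \bar R :=
  ereal_sup [set ent_wrt U | U in lc_open_subspaces V].

End entropy.

Arguments ent R {K V} phi.

(* Main.v *)
(* The map phi sends T_(n+1)/T_n onto T_(n+2)/T_(n+1), so the increments of
   dim (T_n(phi, U) / U) are nonincreasing, hence eventually equal to a natural
   number alpha, and H(phi, U) = alpha. All the dimensions are finite, because an
   open subspace of a linearly compact space has finite codimension. If U <= U',
   then dim (T_n(U) / U) <= dim (T_n(U') / U') + dim (U' / U), so H(phi, U) is
   monotone in U. On the product, H(phi, U1 x U2) = H(phi1, U1) + H(phi2, U2), and
   the subspaces U1 x U2 are cofinal: U is contained in the product of its two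
   projections, which are again open and linearly compact. *)

Require Import Defs.
From mathcomp Require Import all_boot all_order all_algebra.
From mathcomp Require Import finmap zify ring.
From mathcomp Require Import all_classical all_reals topology ereal normedtype sequences.

Set Implicit Arguments.
Unset Strict Implicit.
Unset Printing Implicit Defensive.

Import Order.TTheory GRing.Theory Num.Theory.
Import numFieldNormedType.Exports.
Local Open Scope classical_set_scope.
Local Open Scope ring_scope.

Local Notation subspace_set W := (submod_closed [in W]).

(** * Subspaces and dimensions of quotients *)

Section subspaces.
Context (K : fieldType) (V : lmodType K).
Implicit Types (W : set V) (x y : V) (a : K).

Lemma submod_closedP W : subspace_set W <->
  W 0 /\ forall a x y, W x -> W y -> W (a *: x + y).
Proof.
split=> -[W0 Wl]; split; first by move: W0; rewrite /= inE.
- by move=> a x y Wx Wy; have := Wl a x y; rewrite /= !inE; apply.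
- by rewrite /= inE.
- by move=> a x y; rewrite /= !inE; apply: Wl.
Qed.

Context W (Wsub : subspace_set W).

Lemma submod0 : W 0. Proof. by case/submod_closedP: Wsub. Qed.

Lemma submod_lin a x y : W x -> W y -> W (a *: x + y).
Proof. by case/submod_closedP: Wsub => _; apply. Qed.

Lemma submodD x y : W x -> W y -> W (x + y).
Proof. by move=> Wx Wy; rewrite -[x]scale1r; apply: submod_lin. Qed.

Lemma submodZ a x : W x -> W (a *: x).
Proof. by move=> Wx; rewrite -[_ *: _]addr0; apply: submod_lin => //; apply: submod0. Qed.

Lemma submodN x : W x -> W (- x).
Proof. by move=> Wx; rewrite -scaleN1r; apply: submodZ. Qed.

Lemma submodB x y : W x -> W y -> W (x - y).
Proof. by move=> Wx Wy; apply: submodD => //; apply: submodN. Qed.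

Lemma submodBr x y : W (x - y) -> W y -> W x.
Proof. by move=> Wxy Wy; rewrite -(subrK y x); apply: submodD. Qed.

Lemma submod_sum (I : finType) (F : I -> V) :
  (forall i, W (F i)) -> W (\sum_i F i).
Proof. by move=> WF; elim/big_ind: _ => //; [apply: submod0|apply: submodD]. Qed.

End subspaces.

Lemma submod_prod (K : fieldType) (V1 V2 : lmodType K) (U1 : set V1) (U2 : set V2) :
  subspace_set U1 -> subspace_set U2 ->
  subspace_set (U1 `*` U2 : set (V1 * V2)%type).
Proof.
move=> U1s U2s; apply/submod_closedP; split; first by split; exact: submod0.
by move=> a x y [? ?] [? ?]; split; exact: submod_lin.
Qed.

Section families.
Context (X : Type) (m n : nat) (b : 'I_m -> X) (c : 'I_n -> X).

Definition cat_family (i : 'I_(m + n)) : X :=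
  match fintype.split i with inl j => b j | inr j => c j end.

Lemma cat_familyl i : cat_family (lshift n i) = b i.
Proof. by rewrite /cat_family (unsplitK (inl i)). Qed.

Lemma cat_familyr i : cat_family (rshift m i) = c i.
Proof. by rewrite /cat_family (unsplitK (inr i)). Qed.

End families.

Lemma sum_cat_family (K : fieldType) (V : lmodType K) m n
    (b : 'I_m -> V) (c : 'I_n -> V) (a : 'I_(m + n) -> K) :
  \sum_i a i *: cat_family b c i =
  \sum_i a (lshift n i) *: b i + \sum_i a (rshift m i) *: c i.
Proof.
rewrite big_split_ord; congr (_ + _).
  by apply: eq_bigr => i _; rewrite cat_familyl.
by apply: eq_bigr => i _; rewrite cat_familyr.
Qed.

(** The independence clause of [quotient_basis], isolated because it does not involve [T]. *)
Definition free_mod (K : fieldType) (V : lmodType K) (U : set V) n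
    (b : 'I_n -> V) : Prop :=
  forall a : 'I_n -> K, U (\sum_(i < n) a i *: b i) -> forall i, a i = 0.

(** * Bases and dimensions of quotients *)

Section quotient_dimension.
Context (K : fieldType) (V : lmodType K).
Implicit Types (T U W : set V).

(** If [m > n], the coefficient matrix has a nonzero row [v] in its left kernel; the combination of
    the [c i] with coefficients [v] then lies in [U], against independence. The [b j] are arbitrary
    vectors, so they may be the images of a basis. *)
Lemma free_mod_leq U m n (c : 'I_m -> V) (b : 'I_n -> V) :
  subspace_set U -> free_mod U c ->
  (forall i, exists a : 'I_n -> K, U (c i - \sum_j a j *: b j)) ->
  (m <= n)%N.
Proof.
move=> Us cfree /choice[M cM]; rewrite leqNgt; apply/negP => ltnm.
pose A := \matrix_(i < m, j < n) M i j.
have /rowV0Pn[v /sub_kermxP vA0 /eqP] : kermx A != 0.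
  rewrite kermx_eq0; apply/negP => /eqP rkA.
  by have := rank_leq_col A; rewrite rkA leqNgt ltnm.
apply; apply/rowP => i; rewrite mxE.
apply: (cfree (fun i => v 0 i)).
rewrite (_ : \sum_i _ = \sum_i v 0 i *: (c i - \sum_j M i j *: b j)).
  by apply: submod_sum => // k; apply: submodZ.
under [RHS]eq_bigr do rewrite scalerBr scaler_sumr.
rewrite sumrB exchange_big/= [X in _ - X]big1 ?subr0// => j _.
under eq_bigr do rewrite scalerA.
rewrite -scaler_suml; have := congr1 (fun B : 'rV_n => B 0 j) vA0.
rewrite !mxE; under eq_bigr do rewrite mxE.
by move=> ->; rewrite scale0r.
Qed.

(** A relation with nonzero coefficient at [x] can be divided by it, which puts [x] in the span of
    [b] modulo [U]. The [unlift] places [x] at index 0 and shifts [b] by one. *)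
Lemma free_mod_recl U n (b : 'I_n -> V) x :
  subspace_set U -> free_mod U b ->
  (forall a : 'I_n -> K, ~ U (x - \sum_i a i *: b i)) ->
  free_mod U (fun i : 'I_n.+1 => oapp b x (unlift ord0 i)).
Proof.
move=> Us bfree xb a; rewrite big_ord_recl unlift_none /=.
under eq_bigr do rewrite liftK /=.
move=> Ua; have a0 : a ord0 = 0.
  apply/eqP/negPn/negP => a0.
  apply: (xb (fun i => - (a ord0)^-1 * a (lift ord0 i))).
  have := submodZ Us (a ord0)^-1 Ua; rewrite scalerDr scalerA mulVf// scale1r.
  rewrite scaler_sumr -sumrN; congr (U (_ + _)).
  by apply: eq_bigr => i _; rewrite scalerA mulNr scaleNr opprK.
move: Ua; rewrite a0 scale0r add0r => /bfree bz i.
by case: (unliftP ord0 i) => [j|] ->.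
Qed.

(** The bound yields a longest independent family in [T]; it spans, since otherwise [free_mod_recl]
    would lengthen it. *)
Lemma free_mod_bounded_basis T U N : subspace_set U ->
  (forall m (c : 'I_m -> V), (forall i, T (c i)) -> free_mod U c -> (m <= N)%N) ->
  exists2 n, (n <= N)%N & exists b : 'I_n -> V, quotient_basis T U b.
Proof.
move=> Us bound.
pose P m := `[< exists2 c : 'I_m -> V, forall i, T (c i) & free_mod U c >].
have P0 : exists m, P m.
  by exists 0%N; apply/asboolP; exists (fun=> 0) => [[]|? ? []].
have Pbound m : P m -> (m <= N)%N by move=> /asboolP[c]; apply: bound.
have [n /asboolP[b Tb bfree] nmax] := ex_maxnP P0 Pbound.
exists n; first exact: bound bfree.
exists b; split => // x Tx; apply: contrapT => /forallNP xb.
have /nmax : P n.+1; last by rewrite ltnn.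
apply/asboolP; exists (fun i => oapp b x (unlift ord0 i)).
  by move=> i; case: unlift.
exact: free_mod_recl.
Qed.

Lemma quotient_basis_leq T U m n (c : 'I_m -> V) (b : 'I_n -> V) :
  subspace_set U -> (forall i, T (c i)) -> free_mod U c ->
  quotient_basis T U b -> (m <= n)%N.
Proof.
by move=> Us Tc cfree [_ _ bspan]; apply: (free_mod_leq Us cfree) => i; apply: bspan.
Qed.

(** Two bases have the same length, so the infimum defining [quotient_dim] runs over a singleton. *)
Lemma quotient_dimE (R : realType) T U n (b : 'I_n -> V) :
  subspace_set U -> quotient_basis T U b ->
  quotient_dim R T U = (n%:R)%:E.
Proof.
move=> Us Tb; rewrite /quotient_dim -[RHS]ereal_inf1; congr ereal_inf.
apply/seteqP; split => [_ [m [c Tc] <-]|_ ->] /=; last by exists n => //; exists b.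
congr (_%:R%:E); apply/eqP; rewrite eqn_leq.
have [Tc1 cfree _] := Tc; have [Tb1 bfree _] := Tb.
by rewrite (quotient_basis_leq Us Tc1 cfree Tb) (quotient_basis_leq Us Tb1 bfree Tc).
Qed.

(** Read modulo [W], a relation loses the coefficients of [b]; those of [c] then vanish modulo
    [U]. *)
Lemma quotient_basis_tower T W U m n (b : 'I_m -> V) (c : 'I_n -> V) :
  subspace_set W -> U `<=` W -> W `<=` T ->
  quotient_basis T W b -> quotient_basis W U c ->
  quotient_basis T U (cat_family b c).
Proof.
move=> Ws UW WT [Tb bfree bspan] [Wc cfree cspan]; split.
- by move=> i; rewrite /cat_family; case: fintype.split => j //; apply: WT.
- move=> a; rewrite sum_cat_family => Ua.
  have bz : forall i, a (lshift n i) = 0.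
    apply: bfree; rewrite -(addrK (\sum_i a (rshift m i) *: c i) (\sum_i _)).
    by apply: submodB => //; [exact: UW|apply: submod_sum => // i; apply: submodZ].
  have cz : forall i, a (rshift m i) = 0.
    by apply: cfree; move: Ua; rewrite big1 ?add0r// => i _; rewrite bz scale0r.
  by move=> i; rewrite -(splitK i); case: fintype.split => j; [exact: bz|exact: cz].
- move=> x /bspan[a /cspan[a' Ux]]; exists (cat_family a a').
  rewrite sum_cat_family opprD addrA; congr (U (_ - _ - _)): Ux.
    by apply: eq_bigr => i _; rewrite cat_familyl.
  by apply: eq_bigr => i _; rewrite cat_familyr.
Qed.

End quotient_dimension.

(** The vectors [f (b i)] span [T'] modulo [U'], so they bound the length of independent families in
    [T']. *)
Lemma quotient_basis_image (K : fieldType) (V V' : lmodType K)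
    (f : {linear V -> V'}) (T U : set V) (T' U' : set V') n (b : 'I_n -> V) :
  subspace_set U' -> (forall x, U x -> U' (f x)) ->
  (forall y, T' y -> exists2 x, T x & U' (y - f x)) ->
  quotient_basis T U b ->
  exists2 m, (m <= n)%N & exists c : 'I_m -> V', quotient_basis T' U' c.
Proof.
move=> Us fU fT [_ _ bspan]; apply: free_mod_bounded_basis => // m c Tc cfree.
apply: (@free_mod_leq _ _ _ _ _ _ (f \o b) Us cfree) => i.
have [x /bspan[a /fU Ua] Ux] := fT _ (Tc i); exists a.
have := submodD Us Ux Ua; rewrite linearB addrA subrK linear_sum/=.
by under eq_bigr do rewrite linearZ.
Qed.

Lemma quotient_basis_prod (K : fieldType) (V1 V2 : lmodType K)
    (T1 U1 : set V1) (T2 U2 : set V2) n1 n2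
    (b1 : 'I_n1 -> V1) (b2 : 'I_n2 -> V2) :
  T1 0 -> T2 0 ->
  quotient_basis T1 U1 b1 -> quotient_basis T2 U2 b2 ->
  quotient_basis (T1 `*` T2) (U1 `*` U2)
    (cat_family (fun i => (b1 i, 0)) (fun i => (0, b2 i)) : _ -> (V1 * V2)%type).
Proof.
move=> T10 T20 [Tb1 free1 span1] [Tb2 free2 span2].
have sumE a : \sum_i a i *: cat_family (fun i => (b1 i, 0))
      (fun i => (0, b2 i)) i =
    (\sum_i a (lshift n2 i) *: b1 i, \sum_i a (rshift n1 i) *: b2 i)
    :> (V1 * V2)%type.
  rewrite sum_cat_family; apply: injective_projections.
    rewrite /= !raddf_sum/= [X in _ + X]big1 ?addr0// => i _.
    by rewrite scaler0.
  rewrite /= !raddf_sum/= [X in X + _]big1 ?add0r// => i _.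
  by rewrite scaler0.
split.
- by move=> i; rewrite /cat_family; case: fintype.split => j; split => /=.
- move=> a; rewrite sumE => -[/= /free1 z1 /free2 z2] i.
  by rewrite -(splitK i); case: fintype.split => j; [exact: z1|exact: z2].
- move=> [x1 x2] [/= /span1[a1 Ua1] /span2[a2 Ua2]]; exists (cat_family a1 a2).
  rewrite sumE; split => /=.
    by under eq_bigr do rewrite cat_familyl.
  by under eq_bigr do rewrite cat_familyr.
Qed.

(** * Linear compactness *)

Section open_subspaces.
Context (K : fieldType) (V : dtvsType K).
Implicit Types (U W N : set V) (x y : V).

Lemma nbhs_translate x N : nbhs x N -> nbhs 0 [set w | N (x + w)].
Proof.
move=> nN; have [[A B] /= [nA nB] sN] :
    nbhs (x, 0) [set z : V * V | N (z.1 + z.2)].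
  by apply: (@dtvs_add_continuous K V (x, 0)); rewrite /= addr0.
by apply: filterS nB => w Bw; apply: (sN (x, w)); split=> //; apply: nbhs_singleton.
Qed.

Lemma nbhs_untranslate x N : nbhs 0 N -> nbhs x [set y | N (y - x)].
Proof.
move=> nN; have [[A B] /= [nA nB] sN] :
    nbhs (x, - x) [set z : V * V | N (z.1 + z.2)].
  by apply: (@dtvs_add_continuous K V (x, - x)); rewrite /= subrr.
by apply: filterS nA => y Ay; apply: (sN (y, - x)); split=> //; apply: nbhs_singleton.
Qed.

Lemma open_subspace W : subspace_set W -> nbhs 0 W -> open W.
Proof.
move=> Ws nW; rewrite openE => x Wx.
by apply: filterS (nbhs_untranslate x nW) => y /= Wyx; exact: submodBr Wx.
Qed.

Lemma closed_subspace W : subspace_set W -> nbhs 0 W -> closed W.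
Proof.
move=> Ws nW x /(_ _ (nbhs_untranslate x nW))[y [Wy Wyx]].
by rewrite -(subKr y x); apply: submodB => //; rewrite -opprB; apply: submodN.
Qed.

Lemma nbhs0_open_subspace U : linear_subspace U -> open U -> nbhs 0 U.
Proof. by move=> Us Uo; apply: open_nbhs_nbhs; split=> //; exact: submod0. Qed.

End open_subspaces.

(** * Linear compactness through directed families of open affine sets *)

Section directed_compactness.
Context (K : fieldType).

(** Three points are used because closure under lines through two points says nothing over the field
    with two elements. The sets so described are the cosets of subspaces and the empty set. *)
Definition affine (V : lmodType K) (A : set V) : Prop :=
  forall a x y z, A x -> A y -> A z -> A (x + a *: (y - z)).

(** The neighbourhood [W] is the same at all points: such a set is empty or a coset of an open
    subspace. *)
Definition open_affine (V : dtvsType K) (A : set V) : Prop :=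
  affine A /\ exists2 W, nbhs 0 W & forall x w, A x -> W w -> A (x + w).

(* An equivalent of linear compactness for an open subspace, every closed variety
   being an intersection of open ones; it passes easily to products and images. *)
Definition directed_compact (V : dtvsType K) (U : set V) : Prop :=
  forall (I : Type) (i0 : I) (G : I -> set V),
    (forall i, [/\ open_affine (G i), G i `<=` U & G i !=set0]) ->
    (forall i j, exists k, G k `<=` G i `&` G j) ->
    exists x, forall i, G i x.

Lemma affine_direction (V : lmodType K) (A : set V) v :
  affine A -> A v -> subspace_set [set w | A (v + w)].
Proof.
move=> Aa Av; apply/submod_closedP; split=> [/=|a x y /= Ax Ay].
  by rewrite addr0.
rewrite (_ : v + _ = v + y + a *: (v + x - v)); first exact: Aa.
by rewrite [v + x]addrC addrK addrA addrAC.
Qed.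

Lemma affine_translate (V : lmodType K) (W : set V) v :
  subspace_set W -> affine [set v + w | w in W].
Proof.
move=> Ws a _ _ _ [x Wx <-] [y Wy <-] [z Wz <-].
exists (x + a *: (y - z)); first by apply: submodD => //; apply: submodZ => //; apply: submodB.
by rewrite opprD addrACA subrr add0r addrA.
Qed.

(** A nonempty open affine subset of [U] is a closed variety, and directedness gives the finite
    intersection property. *)
Lemma linearly_compact_directed (V : dtvsType K) (U : set V) :
  linear_subspace U -> linearly_compact U -> directed_compact U.
Proof.
move=> Us Uc I i0 G GP Gdir.
have Fclosed : range G `<=` closed_variety U.
  move=> _ [i _ <-]; have [[Ga [W nW GW]] GU [v Gv]] := GP i.
  have Ws := affine_direction Ga Gv.
  exists v, [set w | G i (v + w)]; split => //.
  - exact: GU.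
  - move=> w /= Gw; rewrite -(addrK v w) addrC [w + v]addrC.
    by rewrite addrC; apply: submodB => //; exact: GU.
  - apply: closed_subspaceW; apply: closed_subspace => //.
    by apply: filterS nW => w Ww /=; exact: GW.
  - apply/seteqP; split => [x Gx|_ [w Gw <-]//].
    by exists (x - v); rewrite /= addrC subrK.
(* Some single [G k] lies inside all the listed sets; [i0] serves the empty list. *)
have Gseq (s : seq (set V)) : (forall A, A \in s -> exists i, A = G i) ->
    exists k, forall A, A \in s -> G k `<=` A.
  elim: s => [|A s IHs] sG; first by exists i0.
  have [j jA] : exists j, forall B, B \in s -> G j `<=` B.
    by apply: IHs => B Bs; apply: sG; rewrite in_cons Bs orbT.
  have [i Ai] := sG A (mem_head _ _); have [k kij] := Gdir i j.
  exists k => B; rewrite in_cons => /orP[/eqP ->|/jA jB] x /kij[Gix Gjx].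
    by rewrite Ai.
  exact: jB.
have Ffip : finI (range G) id.
  move=> D DG; have [A AD|k Gk] := Gseq (enum_fset D).
    by have := DG A AD; rewrite inE => -[i _ <-]; exists i.
  by have [_ _ [x Gx]] := GP k; exists x => A /Gk; apply.
have [x xF] := Uc _ Fclosed Ffip; exists x => i.
by apply: (xF (G i)); exists i.
Qed.

(** Closed varieties are thickened to open ones by open subspaces [O]. A point common to all
    thickenings is a limit of points of each member of [F], hence lies in it. *)
Lemma directed_linearly_compact (V : dtvsType K) (U : set V) :
  (forall N : set V, nbhs 0 N ->
    exists W, [/\ linear_subspace W, nbhs 0 W & W `<=` N]) ->
  linear_subspace U -> open U -> directed_compact U -> linearly_compact U.
Proof.
move=> Vlin Us Uo Uc F Fclosed Ffip.
have nU := nbhs0_open_subspace Us Uo.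
have FU A : F A -> A `<=` U.
  move=> /Fclosed[v [W [Uv _ WU _ ->]]] _ [w Ww <-].
  by apply: submodD => //; exact: WU.
have Faff A : F A -> affine A.
  by move=> /Fclosed[v [W [_ Ws _ _ ->]]]; apply: affine_translate.
pose I := ({D : {fset set V} | {subset D <= F}} *
  {O : set V | linear_subspace O /\ nbhs 0 O})%type.
pose mkI (D : {fset set V}) (DF : {subset D <= F}) (O : set V)
    (OP : linear_subspace O /\ nbhs 0 O) : I :=
  (exist (fun D : {fset set V} => {subset D <= F}) D DF,
   exist (fun O => linear_subspace O /\ nbhs 0 O) O OP).
pose cap (D : {fset set V}) := [set c | forall A, A \in D -> A c].
(* The finite set [D] is intersected before thickening by [O], so the family is directed: unions of
   the [D] and intersections of the [O] index smaller sets. *)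
pose G (i : I) := [set x | U x /\
  exists2 c, U c /\ cap (sval i.1) c & sval i.2 (x - c)].
have subF0 : {subset (fset0 : {fset set V}) <= F}.
  by move=> A; rewrite in_fset0.
have UsO : linear_subspace U /\ nbhs 0 U by [].
have GP i : [/\ open_affine (G i), G i `<=` U & G i !=set0].
  case: i => -[D DF] [O [Os nO]]; rewrite /G/=; split.
  - split.
      move=> a x y z [Ux [c [Uc' Dc] Oc]] [Uy [d [Ud Dd] Od]] [Uz [e [Ue De] Oe]].
      split; first by apply: submodD => //; apply: submodZ => //; apply: submodB.
      exists (c + a *: (d - e)).
        split; first by apply: submodD => //; apply: submodZ => //; apply: submodB.
        move=> A AD; apply: Faff; [|exact: Dc|exact: Dd|exact: De].
        by have := DF _ AD; rewrite inE.
      rewrite opprD addrACA -scalerBr; apply: submodD => //; apply: submodZ => //.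
      rewrite (_ : y - z - _ = y - d - (z - e)); first exact: submodB.
      by rewrite !opprB addrACA [RHS]addrACA [- z - d]addrC.
    exists (U `&` O); first exact: filterI.
    move=> x w [Ux [c Dc Oc]] [Uw Ow]; split; first exact: submodD.
    by exists c => //; rewrite addrAC; apply: submodD.
  - by move=> x [].
  - have [c [Uc' Dc]] : exists c, U c /\ cap D c.
      (* For empty [D] the finite intersection property gives a point that may lie outside [U], so 0
         is taken instead. *)
      have [[A AD]|noA] := pselect (exists A, A \in D).
        have [c Dc] := Ffip D DF; exists c; split; last by move=> B /Dc.
        by apply: (FU A); [have := DF _ AD; rewrite inE|exact: Dc].
      exists 0; split; first exact: submod0.
      by move=> A AD; case: noA; exists A.
    exists c; split=> //; exists c => //; rewrite subrr; exact: submod0.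
have Gdir i j : exists k, G k `<=` G i `&` G j.
  case: i j => -[D DF] [O [Os nO]] [[D' DF'] [O' [Os' nO']]].
  have DDF : {subset fsetU D D' <= F}.
    by move=> A; rewrite in_fsetU => /orP[/DF|/DF'].
  have OOs : linear_subspace (O `&` O') /\ nbhs 0 (O `&` O').
    split; last exact: filterI.
    apply/submod_closedP; split; first by split; exact: submod0.
    by move=> a x y [? ?] [? ?]; split; apply: submod_lin.
  exists (mkI _ DDF _ OOs) => x [/= Ux [c [Uc' Dc] [Oc Oc']]].
  split; split => //; exists c => //; split => // A AD; apply: Dc;
    by rewrite in_fsetU AD ?orbT.
have [x xG] := Uc _ (mkI _ subF0 _ UsO) G GP Gdir.
exists x => A FA /=; have [v [W [Uv Ws WU Wc AW]]] := Fclosed A FA.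
have DA : {subset (fset1 A : {fset set V}) <= F}.
  by move=> B; rewrite in_fset1 => /eqP ->; rewrite inE.
have [Ux _] := xG (mkI _ subF0 _ UsO).
suff Wxv : W (x - v) by rewrite AW; exists (x - v) => //; rewrite addrC subrK.
have [B Bc BU] := iffLR (closed_subspaceP U W) Wc.
have Bxv : B (x - v).
  (* A point [c] of [A] with [x - c] in [O] provides [w = c - v], an element of [W] inside the
     neighbourhood [N] of [x - v]. *)
  apply: Bc => N /nbhs_translate/Vlin[O [Os nO ON]].
  have OsO : linear_subspace O /\ nbhs 0 O by [].
  have [_ [c [Uc' /(_ A)Dc] /= Oc]] := xG (mkI _ DA _ OsO).
  have : A c by apply: Dc; rewrite in_fset1.
  rewrite AW => -[w Ww wc]; exists w; split.
    by have [] : (B `&` U) w by rewrite BU; split => //; exact: WU.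
  rewrite (_ : w = x - v + (c - x)).
    by apply: ON; rewrite -opprB; apply: submodN.
  by rewrite addrC addrA subrK -wc addrC addKr.
have : (B `&` U) (x - v) by split => //; apply: submodB.
by rewrite BU => -[].
Qed.

(** The coordinates are found in turn: the projections of the [G i] to [V1] have a common point
    [x1], and the fibres over [x1], nonempty by this choice, have a common point [x2]. *)
Lemma directed_compact_prod (V1 V2 : dtvsType K) (U1 : set V1) (U2 : set V2) :
  directed_compact U1 -> directed_compact U2 ->
  directed_compact (U1 `*` U2 : set (V1 * V2)%type).
Proof.
move=> c1 c2 I i0 G GP Gdir.
have [x1 Gx1] : exists x1, forall i, exists x2, G i (x1, x2).
  apply: (c1 I i0 (fun i => [set x1 | exists x2, G i (x1, x2)])) => [i|i j].
    have [[Ga [W [[A1 A2] /= [nA1 nA2] AW] GW]] GU [[v1 v2] Gv]] := GP i; split.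
    - split=> [a x y z [x2 Gx] [y2 Gy] [z2 Gz]|].
        by exists (x2 + a *: (y2 - z2)); exact: Ga Gx Gy Gz.
      exists A1 => // x w [x2 Gx] Aw; exists x2.
      have := GW _ (w, 0) Gx; rewrite /= -[x2 in X in _ -> X]addr0; apply.
      by apply: AW; split => //; exact: nbhs_singleton.
    - by move=> x [x2 /GU[]].
    - by exists v1, v2.
  have [k Gk] := Gdir i j; exists k => x [x2 /Gk[Gi Gj]].
  by split; exists x2.
have [x2 Gx2] : exists x2, forall i, G i (x1, x2).
  apply: (c2 I i0 (fun i => [set x2 | G i (x1, x2)])) => [i|i j].
    have [[Ga [W [[A1 A2] /= [nA1 nA2] AW] GW]] GU _] := GP i; split.
    - split=> [a x y z Gx Gy Gz|].
        by have := Ga a _ _ _ Gx Gy Gz; congr (G i (_, _)); rewrite /= subrr scaler0 addr0.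
      exists A2 => // x w Gx Aw /=.
      have := GW _ (0, w) Gx; rewrite -[x1 in X in _ -> X]addr0; apply.
      by apply: AW; split => //; exact: nbhs_singleton.
    - by move=> x /GU[].
    - exact: Gx1.
  by have [k Gk] := Gdir i j; exists k => x /Gk.
by exists (x1, x2).
Qed.

(** The family is pulled back to [U]: continuity keeps the sets open, and they stay nonempty because
    each [G i] lies in the image. *)
Lemma directed_compact_image (V V' : dtvsType K) (f : {linear V -> V'})
    (U : set V) :
  continuous f -> linear_subspace U -> nbhs 0 U -> directed_compact U ->
  directed_compact [set f x | x in U].
Proof.
move=> fc Us nU Uc I i0 G GP Gdir.
have [x Gx] : exists x, forall i, U x /\ G i (f x).
  apply: (Uc I i0 (fun i => [set x | U x /\ G i (f x)])) => [i|i j].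
    have [[Ga [W nW GW]] GU [_ /[dup]/GU[v Uv <-] Gv]] := GP i; split.
    - split=> [a x y z [Ux Gx] [Uy Gy] [Uz Gz]|].
        split; first by apply: submodD => //; apply: submodZ => //; apply: submodB.
        by rewrite linearD linearZ linearB; exact: Ga.
      exists (U `&` f @^-1` W).
        by apply: filterI => //; apply: (fc 0); rewrite linear0.
      move=> x w [Ux Gx] [Uw Ww]; split; first exact: submodD.
      by rewrite linearD; exact: GW.
    - by move=> x [].
    - by exists v.
  by have [k Gk] := Gdir i j; exists k => x [Ux /Gk[]].
by exists (f x) => i; have [] := Gx i.
Qed.

End directed_compactness.

(** * Open subspaces of linearly compact spaces have finite codimension *)

Section finite_codimension.
Context (K : fieldType).

Definition has_quotient_dim (V : lmodType K) (T U : set V) (n : nat) : Prop :=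
  exists b : 'I_n -> V, quotient_basis T U b.

(** If finitely many vectors spanned [U] modulo [W], they would bound the independent families and a
    finite basis would exist; so the sequence can always be prolonged outside the span of its
    earlier terms. *)
Lemma free_sequence (V : lmodType K) (U W : set V) : subspace_set W -> U 0 ->
  (forall n, ~ has_quotient_dim U W n) ->
  exists2 c : nat -> V, forall n, U (c n) &
    forall n (a : nat -> K), ~ W (c n - \sum_(k < n) a k *: c k).
Proof.
move=> Ws U0 infdim.
(* The implication makes this true of every pair [(n, c)], with 0 as default when [c] leaves [U], so
   that [choice] applies. *)
have next (p : nat * (nat -> V)) : exists x, U x /\ ((forall i, U (p.2 i)) ->
    forall a : nat -> K, ~ W (x - \sum_(k < p.1) a k *: p.2 k)).
  case: p => n c /=; have [Uc|nUc] := pselect (forall i, U (c i)); last by exists 0.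
  apply: contrapT => /forallNP nx.
  have [|n' _ /infdim//] := @free_mod_bounded_basis _ _ U W n Ws.
  move=> m d Ud dfree; apply: (@free_mod_leq _ _ W m n d (fun k => c k) Ws dfree) => i.
  apply: contrapT => /forallNP di; apply: (nx (d i)); split.
    by [].
  by move=> _ a; exact: (di (fun k => a k)).
have [g gP] := choice next.
(* [f n] holds the first [n] vectors chosen and is 0 from index [n] on; the sequence sought is the
   diagonal. *)
pose f := fix f n : nat -> V :=
  if n is n'.+1 then fun i => if i == n' then g (n', f n') else f n' i else fun=> 0.
have Uf n i : U (f n i).
  by elim: n => //= n IHn; case: ifP => // _; have [] := gP (n, f n).
exists (fun n => f n.+1 n) => // n a.
have fE i : (i < n)%N -> f i.+1 i = f n i.
  elim: n {a} => // n IHn; rewrite ltnS leq_eqVlt => /orP[/eqP -> //|lein].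
  by rewrite IHn//= (ltn_eqF lein).
rewrite (eq_bigr (fun k : 'I_n => a k *: f n k)) => [|i _]; last by rewrite fE.
by have [_ /(_ (Uf n) a)] := gP (n, f n); rewrite /= eqxx.
Qed.

(* If the c k are independent modulo W, the open varieties
   c 0 + ... + c (n-1) + W + span(c k, k >= n) decrease with empty intersection. *)
Lemma directed_compact_quotient (V : dtvsType K) (U W : set V) :
  subspace_set U -> subspace_set W -> W `<=` U -> nbhs 0 W ->
  directed_compact U -> exists n, has_quotient_dim U W n.
Proof.
move=> Us Ws WU nW Uc; apply: contrapT => /forallNP infdim.
have [c Uc' cW] := free_sequence Ws (submod0 Us) infdim.
have cfree n (a : nat -> K) : W (\sum_(k < n) a k *: c k) ->
    forall k, (k < n)%N -> a k = 0.
  elim: n => // n IHn; rewrite big_ord_recr/= => Wa.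
  have an0 : a n = 0.
    apply/eqP/negPn/negP => an0; apply: (cW n (fun k => - (a n)^-1 * a k)).
    have := submodZ Ws (a n)^-1 Wa; rewrite scalerDr scalerA mulVf// scale1r addrC.
    rewrite scaler_sumr -sumrN; congr (W (_ + _)).
    by apply: eq_bigr => i _; rewrite scalerA mulNr scaleNr opprK.
  move: Wa; rewrite an0 scale0r addr0 => /IHn a0 k.
  by rewrite ltnS leq_eqVlt => /orP[/eqP ->|/a0].
(* The eventual congruence forces [a] to be finitely supported: consecutive partial sums differ by
   [a m *: c m], which lies in [W] only if [a m = 0]. *)
pose A n := [set x | U x /\ exists a : nat -> K, (forall k, (k < n)%N -> a k = 1) /\
  \forall m \near \oo, W (x - \sum_(k < m) a k *: c k)].
have [x xA] : exists x, forall n, A n x.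
  apply: (Uc nat 0%N A) => [n|i j]; first split.
  - split.
      move=> r x y z [Ux [a [a1 Wa]]] [Uy [b [b1 Wb]]] [Uz [d [d1 Wd]]].
      split; first by apply: submodD => //; apply: submodZ => //; apply: submodB.
      exists (fun k => a k + r * (b k - d k)); split.
        by move=> k kn; rewrite a1// b1// d1// subrr mulr0 addr0.
      near=> m.
      rewrite (_ : _ - _ = x - \sum_(k < m) a k *: c k +
        r *: (y - \sum_(k < m) b k *: c k - (z - \sum_(k < m) d k *: c k))).
        apply: submodD => //; first by near: m.
        by apply: submodZ => //; apply: submodB => //; near: m.
      under eq_bigr do rewrite scalerDl -scalerA scalerBl.
      rewrite big_split/= -scaler_sumr sumrB opprD addrACA -scalerBr.
      congr (_ + _ *: _).
      by rewrite !opprB addrACA [RHS]addrACA [_ - z]addrC.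
    exists W => // x w [Ux [a [a1 Wa]]] Ww; split.
      by apply: submodD => //; exact: WU.
    exists a; split => //; near=> m; rewrite addrAC; apply: submodD => //.
    by near: m.
  - by move=> x [].
  - exists (\sum_(k < n) c k); split; first exact: submod_sum.
    exists (fun k => (k < n)%N%:R); split=> [k -> //|].
    exists n => // m /= nm; rewrite (big_ord_widen m) // big_mkcond /=.
    rewrite (eq_bigr (fun k : 'I_m => (k < n)%N%:R *: c k)) ?subrr; first exact: submod0.
    by move=> k _; case: ifP => _; rewrite ?scale1r ?scale0r.
  - exists (maxn i j) => x [Ux [a [a1 Wa]]].
    by split; split => //; exists a; split => // k kn; apply: a1; rewrite leq_max kn ?orbT.
(* From rank [m] on, the partial sums for [a] agree with [x] modulo [W], so [a m = 0]; an expansion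
   of [x] taken from [A m.+1] has [b m = 1], against uniqueness of coordinates. *)
have [_ [a [_ [m _ Wa]]]] := xA 0%N.
have [_ [b [b1 [m' _ Wb]]]] := xA m.+1.
have am0 : a m = 0.
  have := submodB Ws (Wa m (leqnn m)) (Wa m.+1 (leqnSn m)).
  rewrite /= big_ord_recr/= opprB [X in W X]addrC addrA subrK addrAC subrr add0r => Wac.
  apply/eqP/negPn/negP => am0; apply: (cW m (fun=> 0)).
  rewrite big1 ?subr0 => [|i _]; last by rewrite scale0r.
  by rewrite -[c m]scale1r -(mulVf am0) -scalerA; exact: submodZ.
have : b m - a m = 0.
  (* At this length both congruences hold and the index [m] occurs in the sum. *)
  apply: (cfree (maxn m.+1 m') (fun k => b k - a k)); last by rewrite leq_maxl.
  have am : (m <= maxn m.+1 m')%N by rewrite (leq_trans _ (leq_maxl _ _)).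
  have := submodB Ws (Wa _ am) (Wb _ (leq_maxr m.+1 m')).
  rewrite /= opprB [X in W X]addrC addrA subrK -sumrN -big_split/=.
  by under eq_bigr do rewrite -scalerBl.
by rewrite am0 b1// subr0 => /eqP; rewrite oner_eq0.
Unshelve. all: by end_near. Qed.

End finite_codimension.

(** * Entropy *)

Section trajectories.
Context (K : fieldType) (V : lmodType K) (phi : {linear V -> V}).
Implicit Types (U : set V).

Lemma trajectoryS U n : trajectory phi U n.+1 =
  [set x | exists u y, [/\ U u, trajectory phi U n y & x = u + phi y]].
Proof.
have phiE (u : 'I_n.+1 -> V) : \sum_(i < n.+1) iter i phi (u i) =
    u ord0 + phi (\sum_(i < n) iter i phi (u (lift ord0 i))).
  by rewrite big_ord_recl linear_sum.
apply/seteqP; split=> [_ [u Uu ->]|_ [u [_ [Uu [v Uv ->] ->]]]].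
  exists (u ord0), (\sum_(i < n) iter i phi (u (lift ord0 i))); split => //.
  by exists (fun i => u (lift ord0 i)).
exists (fun i => oapp v u (unlift ord0 i)) => [i|]; first by case: unlift.
rewrite phiE unlift_none; congr (_ + phi _).
by apply: eq_bigr => i _; rewrite liftK.
Qed.

Lemma trajectory1 U : trajectory phi U 1 = U.
Proof.
apply/seteqP; split=> [_ [u Uu ->]|x Ux]; first by rewrite big_ord1 /=.
by exists (fun=> x) => //; rewrite big_ord1.
Qed.

Lemma trajectory_submod U n :
  subspace_set U -> subspace_set (trajectory phi U n).
Proof.
move=> Us; apply/submod_closedP; split=> [|a _ _ [u Uu ->] [v Uv ->]].
  exists (fun=> 0) => [_|]; first exact: submod0.
  rewrite big1// => i _; by elim: (val i) => //= k IHk; rewrite IHk linear0.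
exists (fun i => a *: u i + v i) => [i|]; first exact: submod_lin.
rewrite scaler_sumr -big_split; apply: eq_bigr => i _ /=.
by elim: (val i) => //= k <-; rewrite linearP.
Qed.

Lemma trajectory_sub U U' n :
  U `<=` U' -> trajectory phi U n `<=` trajectory phi U' n.
Proof. by move=> UU' _ [u Uu ->]; exists u => // i; exact: UU'. Qed.

Lemma trajectory_subS U n : subspace_set U ->
  trajectory phi U n `<=` trajectory phi U n.+1.
Proof.
move=> Us; elim: n => [_ [u Uu ->]|n IHn].
  by rewrite big_ord0; apply: submod0; exact: trajectory_submod.
rewrite trajectoryS [X in _ `<=` X]trajectoryS => _ [u [y [Uu Ty ->]]].
by exists u, y; split => //; exact: IHn.
Qed.

(** The length starts at 1 because the trajectory of length 0 is the zero space. *)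
Lemma sub_trajectory U n : subspace_set U -> U `<=` trajectory phi U n.+1.
Proof.
move=> Us; elim: n => [|n IHn]; first by rewrite trajectory1.
exact: subset_trans IHn (trajectory_subS Us).
Qed.

(** An exact form of H(phi, U) = [alpha]: the dimension of T_n / U is eventually affine in n with
    slope [alpha], so that comparisons and sums take place among natural numbers. *)
Definition eventual_dim U (alpha : nat) : Prop := exists N c : nat,
  forall n, has_quotient_dim (trajectory phi U (n + N.+1)) U (c + n * alpha).

(** Raising the threshold lets two subspaces be compared at the same trajectory length. *)
Lemma eventual_dim_shift U alpha N c :
  (forall n, has_quotient_dim (trajectory phi U (n + N.+1)) U (c + n * alpha)) ->
  forall m, exists d, forall n,
    has_quotient_dim (trajectory phi U (n + (m + N).+1)) U (d + n * alpha).
Proof.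
move=> H m; exists (c + m * alpha)%N => n; have := H (n + m)%N.
by rewrite -addnS [(n + (m + _))%N]addnA mulnDl [(n * _ + _)%N]addnC addnA.
Qed.

(** Surjectivity comes from T_(n+3) = U + phi T_(n+2), where U lies in T_(n+2). *)
Lemma quotient_dim_step U n k : subspace_set U ->
  has_quotient_dim (trajectory phi U n.+2) (trajectory phi U n.+1) k ->
  exists2 k', (k' <= k)%N &
    has_quotient_dim (trajectory phi U n.+3) (trajectory phi U n.+2) k'.
Proof.
move=> Us [b Tb]; apply: (@quotient_basis_image _ _ _ phi _ _ _ _ _ b _ _ _ Tb).
- exact: trajectory_submod.
- move=> x Tx; rewrite trajectoryS; exists 0, x.
  by split; rewrite ?add0r//; exact: submod0.
- move=> y; rewrite trajectoryS => -[u [x [Uu Tx ->]]]; exists x => //.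
  by rewrite addrK; exact: sub_trajectory.
Qed.

Lemma has_quotient_dim_leq (T U : set V) m n : subspace_set U ->
  has_quotient_dim T U m -> has_quotient_dim T U n -> (m <= n)%N.
Proof. by move=> Us [c [Tc cfree _]] [b]; exact: quotient_basis_leq cfree. Qed.

Lemma nonincreasing_nat_stationary (u : nat -> nat) :
  (forall n, (u n.+1 <= u n)%N) -> exists N, forall n, u (n + N)%N = u N.
Proof.
move=> u_le; pose P k := `[< exists n, u n = k >].
have P0 : exists k, P k by exists (u 0%N); apply/asboolP; exists 0%N.
have [_ /asboolP[N <-] umin] := ex_minnP P0; exists N => n.
apply/eqP; rewrite eqn_leq umin ?andbT; last by apply/asboolP; exists (n + N)%N.
by elim: n => // n; apply: leq_trans; exact: u_le.
Qed.

(** The hypothesis makes the first increment finite, since [phi] maps [U] onto (U + phi U) / U and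
    sends the given subspace to 0; the later increments follow by [quotient_dim_step]. *)
Lemma eventual_dim_exists U k : subspace_set U ->
  has_quotient_dim U (U `&` phi @^-1` U) k -> exists alpha, eventual_dim U alpha.
Proof.
move=> Us [b Tb].
have incr n : exists m,
    has_quotient_dim (trajectory phi U n.+2) (trajectory phi U n.+1) m.
  elim: n => [|n [m /(quotient_dim_step Us)[m' _ ?]]]; last by exists m'.
  rewrite trajectoryS trajectory1.
  have [||m _] := @quotient_basis_image _ _ _ phi _ _
    [set x | exists u y, [/\ U u, U y & x = u + phi y]] U _ b Us _ _ Tb.
  - by move=> x [].
  - by move=> _ [u [y [Uu Uy ->]]]; exists y; rewrite ?addrK.
  - by exists m.
have [beta betaP] := choice incr.
have [N Nbeta] : exists N, forall n, beta (n + N)%N = beta N.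
  apply: nonincreasing_nat_stationary => n.
  have [m mle Tm] := quotient_dim_step Us (betaP n).
  apply: leq_trans mle; apply: has_quotient_dim_leq (betaP _) Tm.
  exact: trajectory_submod.
(* The dimensions of the successive quotients T_(i+2) / T_(i+1) add up along the tower. *)
have dim n : has_quotient_dim (trajectory phi U n.+1) U (\sum_(i < n) beta i)%N.
  elim: n => [|n [c Tc]].
    rewrite trajectory1 big_ord0; exists (fun=> 0); split=> [[]//|? ? []//|x Ux].
    by exists (fun=> 0); rewrite big_ord0 subr0.
  rewrite big_ord_recr/= addnC; have [d Td] := betaP n; exists (cat_family d c).
  apply: (quotient_basis_tower _ _ _ Td Tc).
  - exact: trajectory_submod.
  - exact: sub_trajectory.
  - exact: trajectory_subS.
exists (beta N), N, (\sum_(i < N) beta i)%N => n.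
rewrite addnS (_ : (_ + _ * _)%N = \sum_(i < n + N) beta i)%N//.
elim: n => [|n IHn]; first by rewrite addn0.
by rewrite addSn big_ord_recr/= -IHn Nbeta mulSn addnA addnAC.
Qed.

Lemma eventual_dim_leq U U' k alpha alpha' : subspace_set U -> subspace_set U' ->
  U `<=` U' -> has_quotient_dim U' U k ->
  eventual_dim U alpha -> eventual_dim U' alpha' -> (alpha <= alpha')%N.
Proof.
move=> Us Us' UU' [e U'e] [N [c H]] [N' [c' H']].
have [d dP] := eventual_dim_shift H N'.
have [d' ] := eventual_dim_shift H' N; rewrite [(N + N')%N]addnC => d'P.
rewrite leqNgt; apply/negP => lt.
have {H H'} le n : (d + n * alpha <= d' + n * alpha' + k)%N.
  have [b [Tb bfree _]] := dP n; have [b' Tb'] := d'P n.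
  have T'sub : U' `<=` trajectory phi U' (n + (N' + N).+1).
    by rewrite addnS; exact: sub_trajectory.
  have := quotient_basis_tower Us' UU' T'sub Tb' U'e.
  apply: (quotient_basis_leq Us _ bfree) => i.
  exact: trajectory_sub UU' _ (Tb i).
(* At this length an excess of slope of at least 1 outweighs the constants [d'] and [k]. *)
have := le (d' + k).+1; apply/negP; rewrite -ltnNge.
have : ((d' + k).+1 * alpha'.+1 <= (d' + k).+1 * alpha)%N by rewrite leq_mul2l lt orbT.
by lia.
Qed.

End trajectories.

Lemma ent_wrt_eventual_dim (R : realType) (K : fieldType) (V : dtvsType K)
    (phi : {linear V -> V}) (U : set V) alpha :
  linear_subspace U -> eventual_dim phi U alpha ->
  ent_wrt R phi U = (alpha%:R)%:E.
Proof.
move=> Us [N [c Uc]]; rewrite /ent_wrt; apply: cvg_lim => //.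
rewrite -(cvg_shiftn N.+1) /=.
(* At length [k = n + N + 1] the ratio [(c + n * alpha) / k] equals
   [alpha + (c - (N + 1) * alpha) / k], and [harmonic (n + N)] is [1 / k]. *)
rewrite (_ : (fun n => _) =
    EFin \o (fun n => alpha%:R + (c%:R - N.+1%:R * alpha%:R) * harmonic (n + N)%N)).
  apply: cvg_EFin; first exact: nearW.
  rewrite -[X in _ --> X]addr0; apply: cvgD; first exact: cvg_cst.
  rewrite -(mulr0 (c%:R - N.+1%:R * alpha%:R)); apply: cvgM; first exact: cvg_cst.
  by rewrite (cvg_shiftn N); exact: cvg_harmonic.
apply/funext => n /=; have [b Tb] := Uc n.
rewrite (quotient_dimE R Us Tb) -EFinM; congr EFin.
rewrite /harmonic/= -addnS; set k := (n + N.+1)%N.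
have k0 : k%:R != 0 :> R by rewrite pnatr_eq0 /k addnS.
apply: (mulfI k0); rewrite mulVKf// mulrDr mulrCA mulfV// mulr1 natrD natrM.
by rewrite /k natrD mulrDl addrCA addrA; ring.
Qed.

(** * Linearly compact open subspaces: finite entropy, products and projections *)

Section llc_subspaces.
Context (K : fieldType).

(** By continuity [U] meets its preimage in an open subspace, hence one of finite codimension in
    [U]. *)
Lemma lc_open_subspaces_eventual_dim (V : dtvsType K) (phi : {linear V -> V})
    (U : set V) :
  continuous phi -> lc_open_subspaces V U -> exists alpha, eventual_dim phi U alpha.
Proof.
move=> phic [Us Uo Uc]; have nU := nbhs0_open_subspace Us Uo.
have [|||k] := @directed_compact_quotient _ _ U (U `&` phi @^-1` U) Us _ _ _
  (linearly_compact_directed Us Uc); last exact: eventual_dim_exists.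
- apply/submod_closedP; split=> [|a x y [Ux Upx] [Uy Upy]].
    by split; rewrite /preimage/= ?linear0; exact: (submod0 Us).
  by split; rewrite /preimage/= ?linearP; exact: submod_lin.
- by move=> x [].
- by apply: filterI => //; apply: (phic 0); rewrite linear0.
Qed.

Lemma ent_wrt_le (R : realType) (V : dtvsType K) (phi : {linear V -> V})
    (U U' : set V) :
  continuous phi -> lc_open_subspaces V U -> lc_open_subspaces V U' ->
  U `<=` U' -> (ent_wrt R phi U <= ent_wrt R phi U')%E.
Proof.
move=> phic BU BU' UU'.
have [alpha Ua] := lc_open_subspaces_eventual_dim phic BU.
have [alpha' Ua'] := lc_open_subspaces_eventual_dim phic BU'.
have [Us Uo _] := BU; have [Us' _ Uc'] := BU'.
rewrite (ent_wrt_eventual_dim R Us Ua) (ent_wrt_eventual_dim R Us' Ua') lee_fin ler_nat.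
have [k U'U] := directed_compact_quotient Us' Us UU' (nbhs0_open_subspace Us Uo)
  (linearly_compact_directed Us' Uc').
exact: eventual_dim_leq Us Us' UU' U'U Ua Ua'.
Qed.

Lemma image_submod (V V' : lmodType K) (f : {linear V -> V'}) (U : set V) :
  subspace_set U -> subspace_set [set f x | x in U].
Proof.
move=> Us; apply/submod_closedP; split.
  by exists 0; [exact: submod0|rewrite linear0].
move=> a _ _ [x Ux <-] [y Uy <-]; exists (a *: x + y); first exact: submod_lin.
by rewrite linearP.
Qed.

Lemma linearly_topologized_prod (V1 V2 : dtvsType K) (N : set (V1 * V2)%type) :
  linearly_topologized V1 -> linearly_topologized V2 -> nbhs 0 N ->
  exists W, [/\ linear_subspace W, nbhs 0 W & W `<=` N].
Proof.
move=> [_ lin1] [_ lin2] [[A1 A2] /= [/lin1[W1 [W1s nW1 WA1]] /lin2[W2 [W2s nW2 WA2]]] AN].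
exists (W1 `*` W2); split.
- exact: submod_prod.
- by exists (W1, W2).
- by apply: subset_trans AN => x [/WA1 ? /WA2 ?].
Qed.

Lemma lc_open_subspaces_prod (V1 V2 : dtvsType K) (U1 : set V1) (U2 : set V2) :
  linearly_topologized V1 -> linearly_topologized V2 ->
  lc_open_subspaces V1 U1 -> lc_open_subspaces V2 U2 ->
  lc_open_subspaces (V1 * V2)%type (U1 `*` U2).
Proof.
move=> lin1 lin2 [U1s U1o U1c] [U2s U2o U2c].
have Us := submod_prod U1s U2s.
have Uo : open (U1 `*` U2 : set (V1 * V2)%type).
  apply: open_subspace => //; exists (U1, U2) => //.
  by split; exact: nbhs0_open_subspace.
split=> //; apply: directed_linearly_compact => // [N nN|].
  exact: linearly_topologized_prod.
by apply: directed_compact_prod; exact: linearly_compact_directed.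
Qed.

(** A continuous linear map may fail to be open, so the image is assumed to be a neighbourhood of 0;
    this holds for both coordinate projections. *)
Lemma lc_open_subspaces_image (V V' : dtvsType K) (f : {linear V -> V'})
    (U : set V) :
  linearly_topologized V' -> continuous f -> nbhs 0 [set f x | x in U] ->
  lc_open_subspaces V U -> lc_open_subspaces V' [set f x | x in U].
Proof.
move=> [_ lin] fc nfU [Us Uo Uc]; have fUs := image_submod f Us.
have fUo : open [set f x | x in U] by exact: open_subspace.
split=> //; apply: directed_linearly_compact => //.
apply: directed_compact_image => //; first exact: nbhs0_open_subspace.
exact: linearly_compact_directed.
Qed.

Lemma lc_open_subspaces_fst (V1 V2 : dtvsType K) (U : set (V1 * V2)%type) :
  linearly_topologized V1 -> lc_open_subspaces (V1 * V2)%type U ->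
  lc_open_subspaces V1 [set x.1 | x in U].
Proof.
move=> lin1 BU; apply: (@lc_open_subspaces_image _ _ fst) => //.
  by move=> x A nA; exists (A, setT) => [|y []//]; split => //; exact: filterT.
have [Us Uo _] := BU; case: (nbhs0_open_subspace Us Uo) => -[A1 A2] /= [nA1 nA2] AU.
apply: filterS nA1 => x Ax; exists (x, 0) => //; apply: AU; split => //.
exact: nbhs_singleton.
Qed.

Lemma lc_open_subspaces_snd (V1 V2 : dtvsType K) (U : set (V1 * V2)%type) :
  linearly_topologized V2 -> lc_open_subspaces (V1 * V2)%type U ->
  lc_open_subspaces V2 [set x.2 | x in U].
Proof.
move=> lin2 BU; apply: (@lc_open_subspaces_image _ _ snd) => //.
  by move=> x A nA; exists (setT, A) => [|y []//]; split => //; exact: filterT.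
have [Us Uo _] := BU; case: (nbhs0_open_subspace Us Uo) => -[A1 A2] /= [nA1 nA2] AU.
apply: filterS nA2 => x Ax; exists (0, x) => //; apply: AU; split => //.
exact: nbhs_singleton.
Qed.

End llc_subspaces.

(** * Trajectories and entropy on a product *)

Section product_entropy.
Context (K : fieldType) (V1 V2 : dtvsType K).
Context (phi1 : {linear V1 -> V1}) (phi2 : {linear V2 -> V2}).

Lemma trajectory_prod (U1 : set V1) (U2 : set V2) n :
  trajectory (prod_endo phi1 phi2) (U1 `*` U2) n =
  trajectory phi1 U1 n `*` trajectory phi2 U2 n.
Proof.
have iterE i x : iter i (prod_endo phi1 phi2) x = (iter i phi1 x.1, iter i phi2 x.2).
  by elim: i => [|i IHi]/=; [case: x|rewrite IHi].
apply/seteqP; split=> [_ [u Uu ->]|[_ _] [/= [u1 Uu1 ->] [u2 Uu2 ->]]].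
  rewrite /setX/= !raddf_sum/=; split.
    by exists (fst \o u) => [i|]; [case: (Uu i)|apply: eq_bigr => i _; rewrite iterE].
  by exists (snd \o u) => [i|]; [case: (Uu i)|apply: eq_bigr => i _; rewrite iterE].
exists (fun i => (u1 i, u2 i)) => [i|]; first by split; [exact: Uu1|exact: Uu2].
apply: injective_projections => /=.
  by rewrite raddf_sum/=; apply: eq_bigr => i _; rewrite iterE.
by rewrite raddf_sum/=; apply: eq_bigr => i _; rewrite iterE.
Qed.

Lemma eventual_dim_prod (U1 : set V1) (U2 : set V2) alpha1 alpha2 :
  linear_subspace U1 -> linear_subspace U2 ->
  eventual_dim phi1 U1 alpha1 -> eventual_dim phi2 U2 alpha2 ->
  eventual_dim (prod_endo phi1 phi2) (U1 `*` U2) (alpha1 + alpha2).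
Proof.
move=> U1s U2s [N1 [c1 H1]] [N2 [c2 H2]].
have [d1 dP1] := eventual_dim_shift H1 N2.
have [d2 ] := eventual_dim_shift H2 N1; rewrite [(N1 + N2)%N]addnC => dP2.
exists (N2 + N1)%N, (d1 + d2)%N => n; rewrite trajectory_prod mulnDr addnACA.
have [b1 Tb1] := dP1 n; have [b2 Tb2] := dP2 n; eexists.
by apply: quotient_basis_prod Tb1 Tb2; apply: submod0; exact: trajectory_submod.
Qed.

Lemma ent_wrt_prod (R : realType) (U1 : set V1) (U2 : set V2) :
  continuous phi1 -> continuous phi2 ->
  lc_open_subspaces V1 U1 -> lc_open_subspaces V2 U2 ->
  ent_wrt R (prod_endo phi1 phi2) (U1 `*` U2) =
  (ent_wrt R phi1 U1 + ent_wrt R phi2 U2)%E.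
Proof.
move=> c1 c2 BU1 BU2.
have [alpha1 Ua1] := lc_open_subspaces_eventual_dim c1 BU1.
have [alpha2 Ua2] := lc_open_subspaces_eventual_dim c2 BU2.
have [U1s _ _] := BU1; have [U2s _ _] := BU2.
have Us := submod_prod U1s U2s.
rewrite (ent_wrt_eventual_dim R Us (eventual_dim_prod U1s U2s Ua1 Ua2)).
by rewrite (ent_wrt_eventual_dim R U1s Ua1) (ent_wrt_eventual_dim R U2s Ua2) natrD.
Qed.

Lemma prod_endo_continuous :
  continuous phi1 -> continuous phi2 -> continuous (prod_endo phi1 phi2).
Proof.
move=> c1 c2 [x1 x2] N [[A1 A2] /= [nA1 nA2] AN].
exists (phi1 @^-1` A1, phi2 @^-1` A2); first by split; [exact: c1|exact: c2].
by move=> y [/= ? ?]; apply: AN.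
Qed.

End product_entropy.

(** Finite elements can be moved across an inequality, so the suprema over [y] and then over [x] are
    taken one at a time. *)
Lemma ereal_supD_nneg (R : realType) (A B : set (\bar R)) :
  A !=set0 -> B !=set0 ->
  (forall x, A x -> x \is a fin_num) -> (forall y, B y -> y \is a fin_num) ->
  ereal_sup [set z | exists x y, [/\ A x, B y & z = x + y]%E] =
  (ereal_sup A + ereal_sup B)%E.
Proof.
move=> [x0 Ax0] [y0 By0] Afin Bfin; set C := [set z | _]; apply/eqP.
have ubC x y : A x -> B y -> (x + y <= ereal_sup C)%E.
  by move=> Ax By; apply: ereal_sup_ubound; exists x, y.
rewrite eq_le; apply/andP; split.
  apply: ge_ereal_sup => _ [x [y [Ax By ->]]].
  by apply: leeD; exact: ereal_sup_ubound.
have leB x : A x -> (x + ereal_sup B <= ereal_sup C)%E.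
  move=> Ax; rewrite addeC -leeBrDr ?Afin//; apply: ge_ereal_sup => y By.
  by rewrite leeBrDr ?Afin// addeC ubC.
have [Bsup|] := boolP (ereal_sup B \is a fin_num).
  rewrite -leeBrDr//; apply: ge_ereal_sup => x Ax.
  by rewrite leeBrDr// leB.
have : ereal_sup B != -oo%E.
  by apply: contraTneq (Bfin _ By0) => Boo; have := ereal_sup_ubound By0;
    rewrite Boo leeNy_eq => /eqP ->.
(* Here [ereal_sup B] is [+oo], and the single finite element [x0] already forces [ereal_sup C] to
   be [+oo]. *)
have := leB _ Ax0; case: (ereal_sup B) => // + _ _.
rewrite addey; last by have := Afin _ Ax0; case: (x0).
by rewrite leye_eq => /eqP ->; rewrite leey.
Qed.

Theorem proposition4p6 (R : realType) (K : fieldType) (V1 V2 : dtvsType K)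
    (phi1 : {linear V1 -> V1}) (phi2 : {linear V2 -> V2}) :
  locally_linearly_compact V1 -> locally_linearly_compact V2 ->
  continuous phi1 -> continuous phi2 ->
  ent R (prod_endo phi1 phi2) = (ent R phi1 + ent R phi2)%E.
Proof.
move=> [lin1 [W1 BW1]] [lin2 [W2 BW2]] c1 c2.
have fin (V : dtvsType K) (phi : {linear V -> V}) : continuous phi -> forall x,
    [set ent_wrt R phi U | U in lc_open_subspaces V] x -> x \is a fin_num.
  move=> phic _ [U BU <-]; have [alpha Ua] := lc_open_subspaces_eventual_dim phic BU.
  by have [Us _ _] := BU; rewrite (ent_wrt_eventual_dim R Us Ua).
(* The right side becomes one supremum over pairs of subspaces, leaving two inequalities between
   suprema. *)
rewrite /ent -ereal_supD_nneg.
- apply/eqP; rewrite eq_le; apply/andP; split.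
    apply: ge_ereal_sup => _ [U BU <-].
    have BU1 := lc_open_subspaces_fst lin1 BU.
    have BU2 := lc_open_subspaces_snd lin2 BU.
    apply: (@le_trans _ _ (ent_wrt R (prod_endo phi1 phi2)
        ([set x.1 | x in U] `*` [set x.2 | x in U]))).
      apply: ent_wrt_le => //; first exact: prod_endo_continuous.
        exact: lc_open_subspaces_prod.
      by move=> x Ux; split; exists x.
    rewrite ent_wrt_prod//; apply: ereal_sup_ubound.
    by eexists; eexists; split; [exists [set x.1 | x in U]|exists [set x.2 | x in U]|].
  apply: ge_ereal_sup => _ [_ [_ [[U1 BU1 <-] [U2 BU2 <-] ->]]].
  apply: ereal_sup_ubound; exists (U1 `*` U2); first exact: lc_open_subspaces_prod.
  exact: ent_wrt_prod.
- by exists (ent_wrt R phi1 W1), W1.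
- by exists (ent_wrt R phi2 W2), W2.
- exact: fin.
- exact: fin.
Qed.
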